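(* Let $S$ be a semigroup. The enhanced power graph $\mathcal{P}_e(S)$ is a tree if and only if $|E(S)| = 1$ and $\pi(S) \subseteq \{1,2\}$.
   Context: $E(S)$ denotes the set of all idempotents of $S$. For $z \in S$, $\langle z \rangle = \{z^m : m \geq 1\}$ is the subsemigroup generated by $z$, and the order of $z$ is $o(z) = |\langle z \rangle|$ (possibly infinite). $\pi(S) = \{o(a) : a \in S\}$ is the set of orders of all elements of $S$. The enhanced power graph $\mathcal{P}_e(S)$ of a semigroup $S$ is the simple undirected graph with vertex set $S$ in which two distinct vertices $x, y$ are adjacent if and only if $x, y \in \langle z \rangle$ for some $z \in S$. *)

(* Defs.v *)
From mathcomp Require Import all_boot finmap.
From mathcomp Require Import monoid.
From mathcomp Require Import boolp classical_sets functions cardinality.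

Set Implicit Arguments.
Unset Strict Implicit.
Unset Printing Implicit Defensive.

Local Open Scope classical_set_scope.

(* [None] is the infinite cardinality; all infinite sets are identified. *)
Definition set_size (T : choiceType) (A : set T) : option nat :=
  if `[< finite_set A >] then Some #|` fset_set A|%fset else None.

Record simple_graph (V : Type) := SimpleGraph {
  adj : rel V;
  adj_sym : symmetric adj;
  adj_irr : irreflexive adj
}.

Definition graph_connected (V : Type) (G : simple_graph V) : Prop :=
  inhabited V /\
  forall x y : V, exists2 p : seq V, path (adj G) x p & last x p = y.

(* [ucycle e c]: [c] lists distinct vertices, consecutive ones (cyclically) being
   adjacent. An edge traversed back and forth has size 2, hence the bound. *)
Definition graph_acyclic (V : eqType) (G : simple_graph V) : Prop :=
  ~ exists2 c : seq V, ucycle (adj G) c & (2 < size c)%N.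

Definition is_tree (V : eqType) (G : simple_graph V) : Prop :=
  graph_connected G /\ graph_acyclic G.

Section Semigroup.
Variable S : semigroupType.
Implicit Types x y z : S.

Definition idempotents : set S := [set x | (x * x)%g = x].

(* For [0 < m], [iterop m *%g z z] is the product of [m] copies of [z]; the
   library's [z ^+ m] requires a unit. *)
Definition generated z : set S :=
  [set x | exists2 m : nat, (0 < m)%N & x = iterop m (fun a b => (a * b)%g) z z].

Definition elt_order z : option nat := set_size (generated z).

Definition orders : set (option nat) := range elt_order.

Definition epg_adj : rel S := fun x y =>
  (x != y) && `[< exists z, generated z x /\ generated z y >].

Lemma epg_adj_sym : symmetric epg_adj.
Proof.
move=> x y; rewrite /epg_adj eq_sym; congr (_ && _).
by apply/asboolP/asboolP => -[z [zx zy]]; exists z.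
Qed.

Lemma epg_adj_irr : irreflexive epg_adj.
Proof. by move=> x; rewrite /epg_adj eqxx. Qed.

Definition enhanced_power_graph : simple_graph S :=
  SimpleGraph epg_adj_sym epg_adj_irr.

End Semigroup.

Arguments idempotents S : clear implicits.
Arguments orders S : clear implicits.
Arguments enhanced_power_graph S : clear implicits.

(* Main.v *)
(** An element [z] has order at most 2 iff [z^3] is [z] or [z^2]; then [z^2] is
    idempotent and [<z> = {z, z^2}], so squaring is constant along the edges of
    the enhanced power graph. If the graph is a tree, three distinct elements of
    [<z>] would form a triangle, so all orders are at most 2; by connectedness
    all squares coincide, and they exhaust the idempotents. Conversely, if all
    orders are at most 2 and [e] is the only idempotent, the graph is a star
    centred at [e]. *)
Require Import Defs.
From mathcomp Require Import all_boot finmap monoid.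
From mathcomp Require Import boolp classical_sets cardinality.

Local Open Scope classical_set_scope.

(** Replaces the classical finiteness test by an explicit finite set, whose cardinality can be
    computed. *)
Lemma set_sizeP (T : choiceType) (A : set T) (n : nat) :
  set_size A = Some n <-> exists2 X : {fset T}, A = [set` X] & #|` X|%fset = n.
Proof.
rewrite /set_size; split.
  case: asboolP => // finA [<-].
  by exists (fset_set A) => //; rewrite fset_setK.
case=> X -> <-; rewrite set_fsetK.
by case: asboolP => // -[]; exact: finite_fset.
Qed.

Lemma set_size1P (T : choiceType) (A : set T) :
  set_size A = Some 1 <-> exists e, A = [set e].
Proof.
rewrite set_sizeP; split.
  case=> X -> /eqP /cardfs1P[e ->]; exists e.
  by apply/seteqP; split=> x /=; rewrite inE => /eqP.
case=> e ->; exists [fset e]%fset; last by rewrite cardfs1.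
by apply/seteqP; split=> x /=; rewrite inE => /eqP.
Qed.

Section SmallOrder.
Context {S : semigroupType}.
Implicit Types x y z : S.

Lemma generated_id z : generated z z.
Proof. by exists 1. Qed.

Lemma generated_sqr z : generated z (z * z)%g.
Proof. by exists 2. Qed.

Lemma generated_cube z : generated z (z * (z * z))%g.
Proof. by exists 3. Qed.

(** An equational form of order at most 2. Order 1 is included: [z * z = z] gives both
    alternatives. *)
Definition cube_collapses z :=
  (z * (z * z))%g = z \/ (z * (z * z))%g = (z * z)%g.

Lemma generated_collapse z : cube_collapses z -> generated z = [set z; (z * z)%g].
Proof.
move=> z3; apply/seteqP; split=> [x [[//|m] _ ->]|x [->|->]]; last 2 first.
- exact: generated_id.
- exact: generated_sqr.
(* Left multiplication by [z] maps the pair of [z] and [z * z] into itself. *)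
rewrite iteropS; elim: m => [|m IHm] /=; first by left.
by case: IHm => ->; [right|].
Qed.

(** The fourth power is [z * z^3], and either value of [z^3] reduces it to [z^2]. *)
Lemma cube_collapses_sqr z :
  cube_collapses z -> idempotents S (z * z)%g.
Proof.
by rewrite /idempotents /= -mulgA => -[z3|z3]; rewrite !z3.
Qed.

Lemma not_cube_collapses z : ~ cube_collapses z ->
  uniq [:: z; (z * z)%g; (z * (z * z))%g].
Proof.
move=> nz3; rewrite /= !inE andbT negb_or -andbA; apply/and3P; split; apply/eqP.
- by move=> zz; apply: nz3; right; rewrite -!zz.
- by move=> z3; apply: nz3; left.
- by move=> z3; apply: nz3; right.
Qed.

Lemma elt_order_le2P z :
  [set Some 1; Some 2] (elt_order z) <-> cube_collapses z.
Proof.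
split=> [oz|z3].
  have [n n2 /set_sizeP[X genX cardX]] :
      exists2 n, n <= 2 & set_size (generated z) = Some n.
    by case: oz => oz; [exists 1|exists 2].
  apply: contrapT => /not_cube_collapses uz.
  (* Three distinct powers cannot fit into [X], which has at most two elements. *)
  have sX : {subset [:: z; (z * z)%g; (z * (z * z))%g] <= X}.
    have memX x : generated z x -> x \in X by rewrite genX.
    move=> x; rewrite !inE => /or3P[] /eqP ->; apply: memX.
    - exact: generated_id.
    - exact: generated_sqr.
    - exact: generated_cube.
  by move: n2; rewrite -cardX leqNgt (uniq_leq_size uz sX).
(* The boolean counts as 0 or 1, so the size is 1 exactly when [z] is idempotent. *)
have : set_size (generated z) = Some (z != (z * z)%g).+1.
  apply/set_sizeP; exists [fset z; (z * z)%g]%fset; last by rewrite cardfs2.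
  rewrite generated_collapse //; apply/seteqP; split=> x /=; rewrite !inE.
    by case=> ->; rewrite eqxx ?orbT.
  by case/orP => /eqP ->; [left|right].
by rewrite /elt_order => ->; case: (z != _); [right|left].
Qed.

Lemma orders_le2P :
  orders S `<=` [set Some 1; Some 2] <-> forall z, cube_collapses z.
Proof.
split=> [oS z|z3 _ [z _ <-]]; last exact/elt_order_le2P.
by apply/elt_order_le2P/oS; exists z.
Qed.

Lemma generated_sqr_eq z x : cube_collapses z -> generated z x ->
  (x * x)%g = (z * z)%g.
Proof.
move=> z3; rewrite generated_collapse // => -[->//|->].
exact: cube_collapses_sqr.
Qed.

Lemma acyclic_cube_collapses z :
  graph_acyclic (enhanced_power_graph S) -> cube_collapses z.
Proof.
move=> acyc; apply: contrapT => /not_cube_collapses uz; apply: acyc.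
exists [:: z; (z * z)%g; (z * (z * z))%g] => //; rewrite /ucycle uz andbT.
have adjz x y : generated z x -> generated z y -> x != y -> epg_adj x y.
  by move=> zx zy xy; rewrite /epg_adj xy; apply/asboolP; exists z.
move: uz; rewrite /= !inE negb_or -andbA !andbT => /and3P[z12 z13 z23].
have [g1 g2 g3] := And3 (generated_id z) (generated_sqr z) (generated_cube z).
by apply/and3P; split; apply: adjz => //; rewrite eq_sym.
Qed.

(** Both ends of an edge lie in some [generated z], so both have the square [z * z]. *)
Lemma path_sqr_eq x (p : seq S) : (forall z, cube_collapses z) ->
  path (@epg_adj S) x p -> (x * x)%g = (last x p * last x p)%g.
Proof.
move=> z3; elim: p x => //= y p IHp x /andP[/andP[_ /asboolP[z [zx zy]]] yp].
by rewrite -IHp // (generated_sqr_eq z x) ?(generated_sqr_eq z y).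
Qed.

End SmallOrder.

Section Star.
Context {V : eqType} {G : simple_graph V} {e : V}.

Lemma star_connected : (forall x, x != e -> adj G x e) -> graph_connected G.
Proof.
move=> adje; split=> [|x y]; first exact: (inhabits e).
have [->|xe] := eqVneq x e; have [->|ye] := eqVneq y e.
- by exists [::].
- by exists [:: y] => //=; rewrite adj_sym adje.
- by exists [:: e] => //=; rewrite adje.
- by exists [:: e; y] => //=; rewrite adje // adj_sym adje.
Qed.

(* In a cycle [x, y, w, ...] of length at least 3, one of the edges [xy], [yw]
   and the edge leaving [w] avoids [e]. *)
Lemma star_acyclic :
  (forall x y, adj G x y -> x = e \/ y = e) -> graph_acyclic G.
Proof.
move=> adje [[|x [|y [|w c]]] // /andP[/= /and3P[xy yw wc] /and4P[xN yN wN _]] _].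
(* [v] is the successor of [w] on the cycle: [x] in a triangle, the fourth vertex otherwise. *)
have [v wv vy] : exists2 v, adj G w v & v != y.
  case: c wc xN yN {wN} => [|v c] /= /andP[wv _]; rewrite !inE.
    by move=> /norP[nxy _] _; exists x.
  by move=> _ /norP[_ /norP[nyv _]]; exists v; rewrite // eq_sym.
move: xN yN; rewrite !inE => /norP[nxy /norP[nxw _]] /norP[nyw _].
(* If [x] is the centre, the edge [yw] avoids it; if [y] is, the edge [wv] does. *)
case: (adje _ _ xy) => ?; subst.
  by case: (adje _ _ yw) => ?; subst; rewrite eqxx in nxy nxw.
by case: (adje _ _ wv) => ?; subst; rewrite eqxx in nyw vy.
Qed.

End Star.

Theorem corollary3p10 (S : semigroupType) :
  is_tree (enhanced_power_graph S) <->
  (set_size (idempotents S) = Some 1%N /\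
   orders S `<=` [set Some 1%N; Some 2%N]).
Proof.
rewrite orders_le2P set_size1P; split.
  case=> -[[x0] conn] acyc.
  have z3 (z : S) : cube_collapses z by exact: acyclic_cube_collapses.
  (* Any vertex [x0] serves: an idempotent [f] is its own square, and a path joins [x0] to [f]. *)
  split=> //; exists (x0 * x0)%g; apply/seteqP; split=> [f ff|_ ->].
    have [p xp pf] := conn x0 f.
    by have := path_sqr_eq _ _ z3 xp; rewrite pf ff => <-.
  exact: cube_collapses_sqr.
case=> -[e Ee] z3.
have sqre (z : S) : (z * z)%g = e.
  by have := cube_collapses_sqr _ (z3 z); rewrite Ee.
split.
  apply: (@star_connected _ _ e) => x xe; rewrite /= /epg_adj xe.
  apply/asboolP; exists x; split; first exact: generated_id.
  by rewrite -(sqre x); exact: generated_sqr.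
apply: (@star_acyclic _ _ e) => x y /andP[xy /asboolP[z []]].
(* Both ends lie in the pair of [z] and [e]; being distinct, they cannot both be [z]. *)
rewrite generated_collapse // sqre => -[xz|->]; last by move=> _; left.
by case=> [yz|->]; [rewrite xz yz eqxx in xy|right].
Qed.
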